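(* Fix $d,n\in\mathbb{N}$, and let $T$ denote a complex $d\times d$ matrix. Then the following hold: (i) Assume that $T$ has $d$ distinct eigenvalues $\omega_1,\omega_2,\dots,\omega_d$, each being an $n$th root of unity, and let $U$ be an invertible $d\times d$ matrix such that $T=U\,\mathrm{diag}(\omega_1,\dots,\omega_d)\,U^{-1}$. Let $f_1\in\mathbb{C}^d$ denote an arbitrary vector with nonzero entries (i.e., all entries nonzero). Then, letting $\varphi:=Uf_1$, the sequence $\{T^{k-1}\varphi\}_{k=1}^n$ is a cyclic frame for $\mathbb{C}^d$. (ii) Assume that $\{T^{k-1}\varphi\}_{k=1}^n$ is a cyclic frame for $\mathbb{C}^d$ for some $\varphi\in\mathbb{C}^d$. Then $T$ is diagonalizable and has $d$ distinct eigenvalues $\omega_1,\omega_2,\dots,\omega_d$, each being an $n$th root of unity. Furthermore, writing $T=U\,\mathrm{diag}(\omega_1,\dots,\omega_d)\,U^{-1}$ with $U$ an invertible $d\times d$ matrix, the vector $\varphi$ has the form $\varphi=Uf_1$ for a vector $f_1\in\mathbb{C}^d$ with all coordinates nonzero.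
   Context: A finite family (repetitions allowed) in $\mathbb{C}^d$ is a frame for $\mathbb{C}^d$ iff it spans $\mathbb{C}^d$. For a linear operator (matrix) $T:\mathbb{C}^d\to\mathbb{C}^d$ and $\varphi\in\mathbb{C}^d$, the family $\{T^{k-1}\varphi\}_{k=1}^n$ is called a cyclic frame for $\mathbb{C}^d$ if it is a frame for $\mathbb{C}^d$ and $T^n=I$ (the identity). *)

(* Defs.v *)
From HB Require Import structures.
From mathcomp Require Import all_boot all_order all_algebra.
From mathcomp Require Import reals complex.

Set Implicit Arguments.
Unset Strict Implicit.
Unset Printing Implicit Defensive.

Import GRing.Theory.
Local Open Scope ring_scope.

(* The field C is R[i] for R : realType. *)

Definition is_frame (R : realType) (d n : nat) (f : 'I_n -> 'cV[R[i]]_d) : Prop :=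
  (<<[seq f k | k : 'I_n]>> = fullv)%VS.

(* The family T^(k-1) phi, 1 <= k <= n, is indexed here from k = 0. *)
Definition cyclic_frame (R : realType) (d n : nat)
    (T : 'M[R[i]]_d) (phi : 'cV[R[i]]_d) : Prop :=
  is_frame (fun k : 'I_n => T ^+ k *m phi) /\ T ^+ n = 1%:M.

Definition distinct_unity_eigenvalues (R : realType) (d n : nat)
    (T : 'M[R[i]]_d) (omega : 'I_d -> R[i]) : Prop :=
  [/\ injective omega,
      forall j, eigenvalue T (omega j)
    & forall j, n.-unity_root (omega j)].

Definition diagonalized_by (R : realType) (d : nat)
    (T U : 'M[R[i]]_d) (omega : 'I_d -> R[i]) : Prop :=
  U \in unitmx /\ T = U *m diag_mx (\row_j omega j) *m invmx U.

(* MathComp's eigenvalue is defined by row vectors (v *m T = a *: v), whereas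
   here matrices act on column vectors; the two notions agree. *)
Lemma eigenvalue_colP (F : fieldType) (d : nat) (T : 'M[F]_d) (a : F) :
  reflect (exists2 v : 'cV[F]_d, T *m v = a *: v & v != 0) (eigenvalue T a).
Proof.
have -> : eigenvalue T a = eigenvalue T^T a.
  rewrite /eigenvalue /eigenspace !kermx_eq0 !row_free_unit.
  by rewrite -[in RHS](tr_scalar_mx d a) -linearB /= unitmx_tr.
apply: (iffP eigenvalueP) => [[v Hv nz]|[v Hv nz]]; exists v^T.
- by rewrite -[T]trmxK -trmx_mul Hv linearZ.
- by rewrite -[0]trmx0 (inj_eq trmx_inj).
- by rewrite -trmx_mul Hv linearZ.
- by rewrite -[0]trmx0 (inj_eq trmx_inj).
Qed.

(* Main.v *)
Require Import Defs.
From HB Require Import structures.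
From mathcomp Require Import all_boot all_order all_algebra.
From mathcomp Require Import reals complex.
From mathcomp Require Import separable cyclotomic.

Set Implicit Arguments.
Unset Strict Implicit.
Unset Printing Implicit Defensive.

Import GRing.Theory.
Local Open Scope ring_scope.

(** The whole proof reads vectors through left eigenvectors.  A family spans
    column space exactly when no nonzero row vector annihilates all of it, so
    [T^k phi] ([k < n]) is a frame iff the only row [w] with [w T^k phi = 0]
    for all [k < n] is [w = 0].  If the rows of [P]
    are left eigenvectors of [T] for [omega_1, ..., omega_d], that is
    [P T = diag(omega) P], then every combination [w = c P] of them satisfies

      [w T^k phi = \sum_j c_j (P phi)_j omega_j^k],

    and the frame property becomes a question about power sums with weights
    [c_j (P phi)_j].  Three elementary observations then give everything.

    - If the [omega_j] are distinct and [d <= n], the Vandermonde determinant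
      forces all the weights to vanish ([power_sums_eq0]).  This is part (i),
      with [P = U^-1] and [P phi = f1]; here [d <= n] because there are at
      most [n] roots of unity of order [n].  In the other direction it shows
      that [d] eigenvectors for distinct eigenvalues are independent as soon
      as [phi] has a nonzero coordinate on each ([left_eigen_unitmx]).
    - If [(P phi)_j = 0], then the nonzero [j]-th row of [P] annihilates the
      family ([left_eigen_coord_neq0]).
    - If [omega_i = omega_j] with [i != j], then a suitable combination of the
      rows [i] and [j] of [P] annihilates it ([left_eigen_inj]).

    Diagonalizability in part (ii) comes from [T^n = 1] alone: the minimal
    polynomial of [T] divides [X^n - 1], which has simple roots in
    characteristic zero ([diagonalizable_expr_eq1]). *)

(** * Spanning families and annihilating rows *)

(** If the span is proper, the complementary projection is a nonzero
    endomorphism killing the family, and one of its rows is the annihilator. *)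
Lemma span_fullv_annihilator (F : fieldType) (d : nat) (X : seq 'cV[F]_d) :
  <<X>>%VS = fullv <->
  (forall w : 'rV[F]_d, {in X, forall x, w *m x = 0} -> w = 0).
Proof.
split=> [spanX w wX | annX].
  have mulw0 : linfun (mulmx w) = 0 :> 'Hom('cV[F]_d, 'M[F]_1).
    by apply/(fullv_lfunP _ _ spanX) => x /wX wx0; rewrite lfunE lfunE.
  apply/rowP => j; have := congr1 (fun f : 'Hom(_, _) => f (delta_mx j 0)) mulw0.
  by rewrite !lfunE /= -colE => /matrixP/(_ 0 0); rewrite !mxE.
pose g : 'End('cV[F]_d) := (\1 - projv <<X>>)%VF.
have gX x : x \in X -> g x = 0.
  by move=> Xx; rewrite !lfunE /= !lfunE /= projv_id ?subrr ?memv_span.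
pose A := \matrix_(i, j) g (delta_mx j 0) i 0.
have mulA x : A *m x = g x.
  have -> : x = \sum_j x j 0 *: delta_mx j 0.
    by rewrite [LHS]matrix_sum_delta; apply: eq_bigr => j _; rewrite big_ord1.
  rewrite !linear_sum; apply: eq_bigr => j _.
  rewrite !linearZ /= -colE; congr (_ *: _).
  by apply/colP => i; rewrite !mxE.
have A0 : A = 0.
  apply/row_matrixP => i; rewrite row0; apply: annX => x Xx.
  by rewrite -row_mul mulA gX // row0.
apply/eqP; rewrite eqEsubv subvf //=; apply/subvP => x _.
have := mulA x; rewrite A0 mul0mx !lfunE /= !lfunE /= => /esym/eqP.
by rewrite subr_eq0 => /eqP ->; apply: memv_proj.
Qed.

Lemma cyclic_span_annihilator (F : fieldType) (d n : nat) (T : 'M[F]_d)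
    (phi : 'cV[F]_d) :
  (<<[seq T ^+ k *m phi | k : 'I_n]>> = fullv)%VS <->
  (forall w : 'rV[F]_d, (forall k, (k < n)%N -> w *m (T ^+ k *m phi) = 0) ->
     w = 0).
Proof.
split=> [/span_fullv_annihilator annX w w0 | ann].
  by apply: annX => _ /imageP[k _ ->]; apply: w0.
apply/span_fullv_annihilator => w wX; apply: ann => k ltkn.
exact: wX (image_f _ (_ : Ordinal ltkn \in _)).
Qed.

(** * Power sums and left eigenvectors *)

(** The hypothesis on [c] is a linear system whose matrix is a Vandermonde
    matrix with distinct nodes. *)
Lemma power_sums_eq0 (F : fieldType) (d : nat) (omega c : 'I_d -> F) :
  injective omega ->
  (forall k, (k < d)%N -> \sum_j c j * omega j ^+ k = 0) ->
  forall j, c j = 0.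
Proof.
move=> inj_omega sum0 j.
have unitV : Vandermonde d (\row_i omega i) \in unitmx.
  rewrite unitmxE det_Vandermonde unitfE.
  apply/prodf_neq0 => i _; apply/prodf_neq0 => k ltik.
  rewrite !mxE subr_eq0; apply: contraTneq ltik => /inj_omega ->.
  by rewrite ltnn.
have Vc0 : Vandermonde d (\row_i omega i) *m \col_i c i = 0.
  apply/colP => k; rewrite !mxE -[RHS](sum0 k) //.
  by apply: eq_bigr => i _; rewrite !mxE mulrC.
have := mulKmx unitV (\col_i c i); rewrite Vc0 mulmx0 => /colP/(_ j).
by rewrite !mxE.
Qed.

Lemma row_mul_diag (F : fieldType) (d : nat) (a : 'rV[F]_d) (A : 'M[F]_d) j :
  row j (diag_mx a *m A) = a 0 j *: row j A.
Proof. by rewrite row_mul row_diag_mx -scalemxAl -rowE. Qed.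

Lemma unitmx_row_neq0 (F : fieldType) (d : nat) (A : 'M[F]_d) j :
  A \in unitmx -> row j A != 0.
Proof.
move=> unitA; apply/eqP => Aj0.
have /matrixP/(_ 0 j) : row j (A *m invmx A) = 0 by rewrite row_mul Aj0 mul0mx.
by rewrite mulmxV // !mxE eqxx => /eqP; rewrite oner_eq0.
Qed.

Section LeftEigenvectors.

Variables (F : fieldType) (d : nat) (T P : 'M[F]_d) (omega : 'I_d -> F).
Hypothesis PT : P *m T = diag_mx (\row_j omega j) *m P.

Lemma left_eigen_expr k :
  P *m T ^+ k = diag_mx (\row_j (omega j ^+ k)) *m P.
Proof.
elim: k => [|k IHk].
  rewrite expr0 mulmx1; have -> : \row_j (omega j ^+ 0) = const_mx 1.
    by apply/rowP => j; rewrite !mxE.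
  by rewrite diag_const_mx mul1mx.
rewrite exprSr -mulmxE mulmxA IHk -mulmxA PT mulmxA mulmx_diag.
by congr (diag_mx _ *m P); apply/rowP => j; rewrite !mxE exprSr.
Qed.

Lemma left_eigen_power_sum (phi : 'cV[F]_d) (c : 'rV[F]_d) k :
  (c *m P) *m (T ^+ k *m phi) =
  (\sum_j c 0 j * (P *m phi) j 0 * omega j ^+ k)%:M.
Proof.
rewrite mulmxA -[c *m P *m _]mulmxA left_eigen_expr -!mulmxA mul_diag_mx.
rewrite [LHS]mx11_scalar mxE; congr (_%:M); apply: eq_bigr => j _.
by rewrite !mxE mulrCA mulrA [RHS]mulrC mulrA.
Qed.

Lemma left_eigen_unity_root n j :
  (0 < n)%N -> T ^+ n = 1%:M -> row j P != 0 -> n.-unity_root (omega j).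
Proof.
move=> n_gt0 Tn1 /eqP Pj_neq0; rewrite unity_rootE; apply/eqP.
have := left_eigen_expr n; rewrite Tn1 mulmx1 => /(congr1 (row j)).
rewrite row_mul_diag mxE => /esym/eqP.
rewrite -{2}[row j P]scale1r -subr_eq0 -scalerBl scaler_eq0.
by case/orP=> /eqP => [/subr0_eq|].
Qed.

Section CyclicSpan.

Variables (n : nat) (phi : 'cV[F]_d).
Hypothesis span_orbit : (<<[seq T ^+ k *m phi | k : 'I_n]>> = fullv)%VS.

Let ann_eq0 (c : 'rV[F]_d) :
  (forall k, (k < n)%N -> \sum_j c 0 j * (P *m phi) j 0 * omega j ^+ k = 0) ->
  c *m P = 0.
Proof.
move=> sum0; apply: (cyclic_span_annihilator n T phi).1 => // k ltkn.
by rewrite left_eigen_power_sum sum0 // raddf0.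
Qed.

Lemma left_eigen_coord_neq0 j : row j P != 0 -> (P *m phi) j 0 != 0.
Proof.
apply: contra_neq => Pphi0; rewrite rowE; apply: ann_eq0 => k _.
by apply: big1 => i _; rewrite mxE eqxx; case: eqVneq => [->|_];
  rewrite ?Pphi0 ?mulr0 !mul0r.
Qed.

(** Each independence relation among the rows yields weights whose power sums
    all vanish, and no weight can be absorbed by a zero coordinate of [phi]. *)
Lemma left_eigen_unitmx :
  injective omega -> (d <= n)%N -> (forall j, row j P != 0) -> P \in unitmx.
Proof.
move=> inj_omega ledn Pj_neq0; rewrite -row_free_unit -kermx_eq0.
apply/rowV0P => c /sub_kermxP cP0; apply/rowP => j; rewrite mxE.
have sum0 k : (k < d)%N ->
    \sum_j (c 0 j * (P *m phi) j 0) * omega j ^+ k = 0.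
  move=> _; have /matrixP/(_ 0 0) := left_eigen_power_sum phi c k.
  by rewrite cP0 mul0mx !mxE eqxx.
have /eqP := power_sums_eq0 inj_omega sum0 j.
by rewrite mulf_eq0 (negPf (left_eigen_coord_neq0 (Pj_neq0 j))) orbF => /eqP.
Qed.

Lemma left_eigen_inj : P \in unitmx -> injective omega.
Proof.
move=> unitP i j eq_omega; apply/eqP; apply/negPn/negP => neq_ij.
pose a l := (P *m phi) l 0.
(* These coefficients make the weights on [i] and [j] opposite. *)
pose c : 'rV[F]_d := a j *: delta_mx 0 i - a i *: delta_mx 0 j.
have cE l : c 0 l = a j * (l == i)%:R - a i * (l == j)%:R by rewrite !mxE.
have cP0 : c *m P = 0.
  apply: ann_eq0 => k _; rewrite (bigD1 i) //= (bigD1 j) 1?eq_sym //=.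
  rewrite big1 => [|l /andP[/negPf l_i /negPf l_j]]; last first.
    by rewrite cE l_i l_j !mulr0 subr0 !mul0r.
  rewrite !cE !eqxx (negPf neq_ij) eq_sym (negPf neq_ij) /= eq_omega.
  rewrite !mulr0 !mulr1 subr0 sub0r addr0 -/(a i) -/(a j) !mulNr.
  by rewrite [a j * a i]mulrC subrr.
have /rowP/(_ i) : c = 0 by rewrite -[c](mulmxK unitP) cP0 mul0mx.
rewrite cE mxE eqxx (negPf neq_ij) /= mulr0 mulr1 subr0 => /eqP.
by rewrite (negPf (left_eigen_coord_neq0 (unitmx_row_neq0 j unitP))).
Qed.

End CyclicSpan.

Lemma left_eigen_span n (phi : 'cV[F]_d) :
  P \in unitmx -> injective omega -> (d <= n)%N ->
  (forall j, (P *m phi) j 0 != 0) ->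
  (<<[seq T ^+ k *m phi | k : 'I_n]>> = fullv)%VS.
Proof.
move=> unitP inj_omega ledn Pphi_neq0; apply/cyclic_span_annihilator => w w0.
rewrite -[w](mulmxKV unitP); set c := w *m invmx P.
suff -> : c = 0 by rewrite mul0mx.
have sum0 k : (k < d)%N ->
    \sum_j (c 0 j * (P *m phi) j 0) * omega j ^+ k = 0.
  move=> ltkd; have /matrixP/(_ 0 0) := left_eigen_power_sum phi c k.
  by rewrite mulmxKV // w0 ?(leq_trans ltkd) // !mxE eqxx.
apply/rowP => j; rewrite [RHS]mxE; have /eqP := power_sums_eq0 inj_omega sum0 j.
by rewrite mulf_eq0 (negPf (Pphi_neq0 j)) orbF => /eqP.
Qed.

End LeftEigenvectors.

(** * Matrices of finite order *)

Lemma leq_inj_unity_roots (F : fieldType) (d n : nat) (omega : 'I_d -> F) :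
  (0 < n)%N -> injective omega -> (forall j, n.-unity_root (omega j)) ->
  (d <= n)%N.
Proof.
move=> n_gt0 inj_omega root_omega.
rewrite -[d]card_ord -(size_codom omega); apply: max_unity_roots => //.
  by apply/allP => _ /codomP[j ->].
by apply/injectiveP.
Qed.

(** [X ^ n - 1] annihilates [T] and splits into distinct linear factors. *)
Lemma diagonalizable_expr_eq1 (F : closedFieldType) (d n : nat) (T : 'M[F]_d) :
  n%:R != 0 :> F -> T ^+ n = 1%:M -> diagonalizable T.
Proof.
case: d T => [|d] T n_neq0 Tn1.
  by exists 1%:M; rewrite ?unitmx1 // [T]thinmx0; apply/is_diag_mxP => -[].
have n_gt0 : (0 < n)%N by case: (n) n_neq0; rewrite ?eqxx.
have [rs def_rs] := closed_field_poly_normal ('X^n - 1 : {poly F}).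
move: def_rs; rewrite (monicP (monic_Xn_sub_1 _ n_gt0)) scale1r => def_rs.
apply/diagonalizableP; exists rs.
  by rewrite -separable_prod_XsubC -def_rs separable_Xn_sub_1.
rewrite -def_rs; apply: mxminpoly_min.
by rewrite rmorphB rmorphXn /= horner_mx_X rmorph1 [T ^+ n]Tn1 subrr.
Qed.

(** * The characterization of cyclic frames *)

Theorem theorem3p6 (R : realType) (d n : nat) (d_gt0 : (0 < d)%N) (n_gt0 : (0 < n)%N)
    (T : 'M[R[i]]_d) :
  (forall (omega : 'I_d -> R[i]) (U : 'M[R[i]]_d) (f1 : 'cV[R[i]]_d),
      distinct_unity_eigenvalues n T omega ->
      diagonalized_by T U omega ->
      (forall j, f1 j 0 != 0) ->
      cyclic_frame n T (U *m f1))
  /\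
  (forall phi : 'cV[R[i]]_d,
      cyclic_frame n T phi ->
      [/\ diagonalizable T,
          exists omega : 'I_d -> R[i], distinct_unity_eigenvalues n T omega
        & forall omega : 'I_d -> R[i],
            distinct_unity_eigenvalues n T omega ->
            (exists U : 'M[R[i]]_d, diagonalized_by T U omega) /\
            (forall U : 'M[R[i]]_d, diagonalized_by T U omega ->
               exists2 f1 : 'cV[R[i]]_d,
                 phi = U *m f1 & forall j, f1 j 0 != 0)]).
Proof.
have left_eigen_diag (omega : 'I_d -> R[i]) U : diagonalized_by T U omega ->
    invmx U *m T = diag_mx (\row_j omega j) *m invmx U.
  by case=> unitU ->; rewrite -mulmxA mulKmx.
split=> [omega U f1 [inj_omega _ root_omega] diagT f1_neq0 | phi [spanT Tn1]].
  have [unitU defT] := diagT; have eigT := left_eigen_diag _ _ diagT.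
  split.
    apply: (left_eigen_span eigT) => //; first by rewrite unitmx_inv.
      exact: leq_inj_unity_roots root_omega.
    by move=> j; rewrite mulKmx.
  have -> : T ^+ n = U *m (invmx U *m T ^+ n) by rewrite mulKVmx.
  rewrite (left_eigen_expr eigT).
  have -> : \row_j (omega j ^+ n) = const_mx 1.
    by apply/rowP => j; rewrite !mxE; apply/unity_rootP.
  by rewrite diag_const_mx mul1mx mulmxV.
have diagT : diagonalizable T.
  by apply: diagonalizable_expr_eq1 Tn1; rewrite Num.Theory.pnatr_eq0 -lt0n.
split=> //.
  have [P unitP /diagonalizable_forPex[D /(simmxP unitP) PT]] := diagT.
  have eigT : P *m T = diag_mx (\row_j D 0 j) *m P.
    by rewrite PT; congr (diag_mx _ *m P); apply/rowP => j; rewrite mxE.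
  exists (D 0); split=> [|j|j].
  - exact: left_eigen_inj eigT _ _ spanT unitP.
  - apply/eigenvalueP; exists (row j P); last exact: unitmx_row_neq0.
    by rewrite -row_mul PT row_mul_diag.
  - by apply: (left_eigen_unity_root eigT) => //; apply: unitmx_row_neq0.
move=> omega [inj_omega eig_omega root_omega]; split; last first.
  move=> U diagU; have [unitU _] := diagU.
  exists (invmx U *m phi); first by rewrite mulKVmx.
  move=> j; apply: (left_eigen_coord_neq0 (left_eigen_diag _ _ diagU) spanT).
  by apply: unitmx_row_neq0; rewrite unitmx_inv.
have /fin_all_exists2[v vT v_neq0] j := eigenvalueP (eig_omega j).
pose P := \matrix_j v j.
have eigT : P *m T = diag_mx (\row_j omega j) *m P.
  by apply/row_matrixP => j; rewrite row_mul row_mul_diag rowK mxE vT.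
have unitP : P \in unitmx.
  apply: (left_eigen_unitmx eigT spanT) => // [|j]; last by rewrite rowK.
  exact: leq_inj_unity_roots root_omega.
exists (invmx P); split; first by rewrite unitmx_inv.
by rewrite invmxK -mulmxA -eigT mulKmx.
Qed.
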